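(* Let $N \in \mathbb{N}$, $k \ge 1$, $R \in \mathbb{Z}/N\mathbb{Z}$, and $Q = \pi'_N(k)$. Then $f_{k,R}$ is quasipolynomial with quasi-period $Q$; moreover, for each $i \in \{0, 1, \ldots, Q-1\}$ the function $\mathcal{L}^{(i)}_{k,R}$ defined by $f_{k,R}(n) = \mathcal{L}^{(i)}_{k,R}\!\left(\frac{n-i}{Q}\right)$ for $n \equiv i \pmod Q$ is linear, i.e. there are constants $a_i, b_i$ with $f_{k,R}(n) = a_i\frac{n-i}{Q} + b_i$ for all $n \ge k$ with $n \equiv i \pmod{Q}$.
   Context: The Gaussian polynomial is $\begin{bmatrix} n \\ k \end{bmatrix}_q = \frac{[n]!}{[n-k]!\,[k]!}$ with $[m]! = \prod_{i=1}^{m} \frac{1-q^i}{1-q}$, a polynomial of degree $k(n-k)$. For $n \ge k$, $f_{k,R}(n) = \#\{\alpha \in \{0,\ldots,k(n-k)\} : [q^\alpha]\begin{bmatrix} n \\ k \end{bmatrix}_q \equiv R \pmod N\}$. A function $f$ is quasipolynomial with quasi-period $Q$ if there are polynomials $P_0,\ldots,P_{Q-1}$ with $f(n) = P_i(n)$ whenever $n \equiv i \pmod Q$. $p_{\le k}(n)$ is the number of partitions of $n$ with at most $k$ parts; $\pi_N(k)$ is the minimal period of the purely periodic sequence $(p_{\le k}(n) \bmod N)_{n \ge 0}$ (so $\pi_N(1)=1$). Define $\pi'_N(1) = \pi_N(1) = 1$ and for $k \ge 2$: $\pi'_N(k) = \frac{\pi_N(k)}{\pi_N(k-1)}\pi'_N(k-1)$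 if $N$ divides $\frac{\pi_N(k)}{\pi_N(k-1)}$, and $\pi'_N(k) = N\frac{\pi_N(k)}{\pi_N(k-1)}\pi'_N(k-1)$ otherwise. *)

(* Defs.v *)
From mathcomp Require Import all_boot all_order all_algebra.
From mathcomp Require Import boolp classical_sets.

Set Implicit Arguments.
Unset Strict Implicit.
Unset Printing Implicit Defensive.

Import Order.TTheory GRing.Theory Num.Theory.

Local Open Scope ring_scope.

(* The divisors in qfact and gauss have leading coefficient 1 or -1, so %/ on
   {poly int} is the genuine Euclidean division there, and both quotients are
   exact. *)
Definition qfact (m : nat) : {poly int} :=
  \prod_(1 <= i < m.+1) ((1 - 'X^i) %/ (1 - 'X)).

Definition gauss (n k : nat) : {poly int} :=
  qfact n %/ (qfact (n - k) * qfact k).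

(* The residue class R in Z/N is given by its representative in {0, ..., N-1};
   'Z_N would be wrong for N = 1. Meaningful for k <= n only. *)
Definition coef_count (N k : nat) (R : 'I_N) (n : nat) : nat :=
  #|[set a : 'I_(k * (n - k)).+1
       | ((gauss n k)`_a == (R : nat)%:Z %[mod N])%Z]|.

(* A function known on {n | k <= n} is constrained on that domain only. *)
Definition quasipolynomial_from (k Q : nat) (f : nat -> nat) : Prop :=
  (0 < Q)%N /\
  exists P : 'I_Q -> {poly rat}, forall (i : 'I_Q) (n : nat),
    (k <= n)%N -> (n = i %[mod Q])%N -> (f n)%:R = (P i).[n%:R].

(* A partition of n with at most k parts is a weakly decreasing sequence of at
   most k positive integers (each at most n) with sum n. *)
Definition part_le (k n : nat) : nat :=
  #|[set l : k.-bseq 'I_n.+1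
       | let s := [seq nat_of_ord x | x <- l] in
         [&& sorted geq s, all (leq 1) s & sumn s == n]]|.

Definition is_period (u : nat -> nat) (T : nat) : Prop :=
  (0 < T)%N /\ forall n, u (n + T)%N = u n.

Definition is_min_period (u : nat -> nat) (T : nat) : Prop :=
  is_period u T /\ forall T', is_period u T' -> (T <= T')%N.

(* 0 when u is not purely periodic. *)
Definition min_period (u : nat -> nat) : nat :=
  xget 0%N [set T | is_min_period u T].

Definition part_period (N k : nat) : nat :=
  min_period (fun n => part_le k n %% N)%N.

(* Since p_{<=k}(n) - p_{<=k}(n-k) = p_{<=k-1}(n), every period for k is also
   one for k-1; hence the quotient in nat is exact. *)
Definition period_ratio (N k : nat) : nat :=
  (part_period N k %/ part_period N k.-1)%N.

Fixpoint part_period' (N k : nat) : nat :=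
  match k with
  | 0 | 1 => 1%N
  | k'.+1 =>
      if (N %| period_ratio N k)%N
      then (period_ratio N k * part_period' N k')%N
      else (N * period_ratio N k * part_period' N k')%N
  end.

(* Main.v *)
(* Idea. Write D_k = (1 - q)...(1 - q^k), so that 1 / D_k generates p_{<=k}, and
   let T be any period of p_{<=k} mod N. With n = m + k,
     [n choose k]_q = (1 - q^(m+1))...(1 - q^(m+k)) / D_k
                    = sum_(l <= k) q^(l m) C_l(q) / D_k,
   where C_l does not depend on m and deg C_l < deg D_k for l < k. The recurrence
   given by D_k, run backwards, shows that the coefficients of C_l / D_k are
   T-periodic mod N for l < k. Hence on each window j m < a <= (j + 1) m with
   j < k, the coefficient of q^a mod N depends only on j and on m and a - j m
   mod T, and counting the windows gives a function that is linear in m on every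
   class mod T. Finally pi'_N(k) is a multiple of pi_N(k), so it is such a
   period. *)
Require Import Defs.
From mathcomp Require Import all_boot all_order all_algebra.
From mathcomp Require Import boolp classical_sets.
From mathcomp Require Import zify ring.

Set Implicit Arguments.
Unset Strict Implicit.
Unset Printing Implicit Defensive.

Import Order.TTheory GRing.Theory Num.Theory.

Local Open Scope ring_scope.

(** * Partitions with at most [k] parts *)

Definition partition_seq (k n : nat) : pred (seq nat) := fun s =>
  [&& (size s <= k)%N, sorted geq s, all (leq 1) s & sumn s == n].

(** Lets partitions be counted as duplicate-free lists of plain sequences instead of bounded
    sequences of ordinals. *)
Lemma part_le_enum (k n : nat) : exists2 e : seq (seq nat), uniq e &
  e =i partition_seq k n /\ size e = part_le k n.
Proof.
set A := [set l : k.-bseq 'I_n.+1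
  | let s := [seq nat_of_ord x | x <- l] in
    [&& sorted geq s, all (leq 1) s & sumn s == n]].
exists [seq [seq nat_of_ord x | x <- val l] | l <- enum A].
  rewrite map_inj_uniq ?enum_uniq // => l1 l2 /(inj_map val_inj) e12.
  exact: val_inj.
split; last by rewrite size_map -cardE /part_le; apply: eq_card => l; rewrite !inE.
move=> s; apply/mapP/idP => [[l]|].
  rewrite mem_enum inE /= => /and3P[h1 h2 h3] ->.
  by rewrite /in_mem /= /partition_seq h1 h2 h3 size_map size_bseq.
rewrite /in_mem /= => /and4P[sz so po /eqP su].
have sn : all (fun x => x < n.+1)%N s.
  apply/allP => x xs; rewrite ltnS -su.
  by rewrite sumnE (perm_big _ (perm_to_rem xs)) big_cons leq_addr.
have sE : [seq nat_of_ord x | x <- [seq (inord x : 'I_n.+1) | x <- s]] = s.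
  rewrite -map_comp -[RHS]map_id; apply/eq_in_map => x xs /=.
  by rewrite inordK //; exact: (allP sn).
have sz' : (size [seq (inord x : 'I_n.+1) | x <- s] <= k)%N by rewrite size_map.
pose l : k.-bseq 'I_n.+1 := Bseq sz'.
have lA : l \in enum A by rewrite mem_enum inE /= sE so po su eqxx.
by exists l; rewrite //= sE.
Qed.

Lemma size_partition_enum (k n : nat) (e : seq (seq nat)) :
  uniq e -> e =i partition_seq k n -> size e = part_le k n.
Proof.
move=> ue eE; have [e' ue' [eE' <-]] := part_le_enum k n.
by apply/perm_size/uniq_perm => // s; rewrite eE eE'.
Qed.

Lemma sorted_geq_filter_pos (s : seq nat) : sorted geq s ->
  s = filter (leq 1) s ++ nseq (size s - size (filter (leq 1) s)) 0%N.
Proof.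
have geq_tr : transitive geq by move=> a b c /= h1 h2; exact: leq_trans h2 h1.
elim: s => [//|x s IHs] /= so.
have so' := path_sorted so.
case: x so => [|x] so /=; last by rewrite subSS -IHs.
have s0 : all (pred1 0%N) s.
  apply/allP => y ys; have := order_path_min geq_tr so.
  by move=> /allP /(_ y ys) /=; rewrite leqn0.
have -> : filter (leq 1) s = [::].
  apply/eqP; rewrite -size_eq0 size_filter -leqn0 leqNgt -has_count.
  by apply/hasPn => y /(allP s0) /eqP ->.
by rewrite /= -(all_pred1P _ _ s0).
Qed.

(** A partition with at most k+1 parts either has at most k parts, or has exactly k+1 parts and 1
    can be removed from each. *)
Lemma part_leS (k n : nat) : part_le k.+1 n =
  (part_le k n + (if k < n then part_le k.+1 (n - k.+1) else 0))%N.
Proof.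
have [e1 u1 [m1 <-]] := part_le_enum k n.
have [e2 u2 [m2 s2]] := part_le_enum k.+1 (n - k.+1)%N.
(* [f] amounts to padding with zeros to k+1 parts and raising every part by 1; [g] lowers the parts
   and discards the zeros. *)
pose f (s : seq nat) := map S s ++ nseq (k.+1 - size s) 1%N.
pose g (t : seq nat) := filter (leq 1) (map predn t).
have fg t : size t = k.+1 -> sorted geq t -> all (leq 1) t -> f (g t) = t.
  move=> st so po.
  have sp : sorted geq (map predn t).
    by apply: homo_sorted so => x y /= xy; lia.
  have tE : t = map S (map predn t).
    rewrite -map_comp -[LHS]map_id; apply/eq_in_map => x /(allP po) /=; lia.
  rewrite [RHS]tE (sorted_geq_filter_pos sp) map_cat map_nseq /f /g.
  by rewrite size_map st.
have gf s : all (leq 1) s -> g (f s) = s.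
  move=> po; rewrite /g /f map_cat -map_comp map_id_in; last by [].
  rewrite map_nseq filter_cat; have /all_filterP -> := po.
  by rewrite (_ : filter _ (nseq _ _) = [::]) ?cats0 //; elim: (_ - _)%N.
have sum_f s : (size s <= k.+1)%N -> sumn (f s) = (sumn s + k.+1)%N.
  move=> ss; rewrite /f sumn_cat sumn_nseq mul1n.
  have -> : sumn (map S s) = (sumn s + size s)%N.
    by elim: s {ss} => //= x s ->; lia.
  lia.
have size_f s : (size s <= k.+1)%N -> size (f s) = k.+1.
  by move=> ss; rewrite /f size_cat size_map size_nseq; lia.
have f_pos s : all (leq 1) (f s).
  rewrite /f all_cat all_map; apply/andP; split; first exact/allP.
  by apply/allP => x /nseqP [-> _].
have f_sorted s : sorted geq s -> sorted geq (f s).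
  have geq_tr : transitive geq by move=> a b c /= h1 h2; exact: leq_trans h2 h1.
  move=> so; rewrite /f (sorted_pairwise geq_tr) pairwise_cat; apply/and3P; split.
  - by apply/allrelP => x y /mapP[z _ ->] /nseqP[-> _] /=.
  - by rewrite pairwise_map; rewrite (sorted_pairwise geq_tr) in so.
  - by elim: (_ - _)%N => //= m ->; rewrite andbT; apply/allP => x /nseqP[-> _].
have e2P s : s \in e2 -> [/\ (size s <= k.+1)%N, sorted geq s,
    all (leq 1) s & sumn s = (n - k.+1)%N].
  by rewrite m2 /in_mem /= => /and4P[? ? ? /eqP ?].
case: ltnP => kn; last first.
  rewrite addn0; apply/esym/size_partition_enum => // s.
  rewrite m1 /in_mem /= /partition_seq.
  case: (ltngtP (size s) k.+1) => ss; rewrite ?ltnS in ss; first by rewrite ss.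
    by rewrite leqNgt (ltn_trans _ ss).
  rewrite leqNgt ss ltnSn /=; symmetry; apply/negbTE; apply/negP => /and3P[_ po /eqP su].
  have : (size s <= sumn s)%N.
    by elim: s po {ss su} => //= x s IH /andP[x0 /IH]; lia.
  lia.
rewrite -s2 -(size_map f e2) -size_cat; apply/esym/size_partition_enum.
  rewrite cat_uniq u1 map_inj_in_uniq ?u2 ?andbT /=; last first.
    by move=> s t /e2P[_ _ ps _] /e2P[_ _ pt _] /(congr1 g); rewrite !gf.
  apply/hasPn => t /mapP[s /e2P[ss _ _ _] ->] /=.
  by rewrite m1 /in_mem /= /partition_seq size_f // ltnn.
move=> t; rewrite mem_cat m1 /in_mem /= /partition_seq.
apply/orP/idP => [[/and4P[h1 -> -> ->]|/mapP[s /e2P[ss so po su] ->]]|].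
- by rewrite leqW.
- by rewrite size_f // leqnn f_sorted // f_pos sum_f // su subnK //=.
move=> /and4P[st so po /eqP su].
move: st; rewrite leq_eqVlt ltnS => /orP[/eqP st|->]; last by left; rewrite so po su eqxx.
right; apply/mapP; exists (g t); last by rewrite fg.
have sg : (size (g t) <= k.+1)%N by rewrite size_filter (leq_trans (count_size _ _)) ?size_map ?st.
rewrite m2 /in_mem /= /partition_seq sg filter_all /=.
have := sum_f _ sg; rewrite fg // su => ->; rewrite addnK eqxx andbT.
apply: sorted_filter; first by move=> a b c /= h1 h2; exact: leq_trans h2 h1.
by apply: homo_sorted so => x y /= xy; lia.
Qed.

Lemma part_le0 (n : nat) : part_le 0 n = (n == 0%N).
Proof.
apply/esym; rewrite -(@size_partition_enum 0 n (nseq (n == 0%N) [::])) ?size_nseq //.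
  by case: (n == _).
case=> [|x s]; rewrite /in_mem /= /partition_seq /= ?eqxx; first by case: n.
by case: n.
Qed.

Lemma part_le1 (n : nat) : part_le 1 n = 1%N.
Proof.
elim: n => [|n IHn]; first by rewrite part_leS part_le0.
by rewrite part_leS part_le0 subn1 IHn.
Qed.

(** * Periods *)

Lemma sum_periodic (h : nat -> nat) (T t r : nat) :
  (forall n, h (n + T)%N = h n) ->
  (\sum_(0 <= i < r + t * T) h i =
     \sum_(0 <= i < r) h i + t * \sum_(0 <= i < T) h i)%N.
Proof.
move=> hT.
have step a : (\sum_(0 <= i < a + T) h i =
    \sum_(0 <= i < a) h i + \sum_(0 <= i < T) h i)%N.
  elim: a => [|a IHa]; first by rewrite add0n (big_geq (leqnn 0)) add0n.
  by rewrite addSn !big_nat_recr //= IHa hT addnAC.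
elim: t => [|t IHt]; first by rewrite !mul0n !addn0.
by rewrite !mulSn [(T + _)%N]addnC addnA step IHt -addnA [(_ + t * _)%N]addnC.
Qed.

Lemma is_periodM (u : nat -> nat) (T j n : nat) :
  is_period u T -> u (n + j * T)%N = u n.
Proof.
move=> [_ uT]; elim: j => [|j IHj]; first by rewrite addn0.
by rewrite mulSn addnCA addnC uT.
Qed.

Lemma min_periodP (u : nat -> nat) :
  (exists T, is_period u T) -> is_min_period u (min_period u).
Proof.
move=> [T uT]; apply: (@xgetPex _ 0%N [set T | is_min_period u T]).
have exP : exists T, `[< is_period u T >] by exists T; apply/asboolP.
case: (ex_minnP exP) => M /asboolP uM minM; exists M; split => // T' uT'.
by apply: minM; apply/asboolP.
Qed.

Lemma min_period_dvd (u : nat -> nat) (T : nat) :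
  is_period u T -> (min_period u %| T)%N.
Proof.
move=> uT; have [uM minM] := min_periodP (ex_intro _ T uT).
set M := min_period u in uM minM *.
have [/eqP //|nz] := posnP (T %% M).
have /minM : is_period u (T %% M).
  split=> // n; rewrite -(is_periodM (T %/ M) _ uM) -addnA [(T %% M + _)%N]addnC.
  by rewrite -divn_eq; case: uT.
by rewrite leqNgt ltn_mod; case: uM => ->.
Qed.

Lemma part_le_period (N k : nat) : (0 < N)%N -> (0 < k)%N ->
  exists T, is_period (fun n => part_le k n %% N)%N T.
Proof.
move=> N0; case: k => // k _; elim: k => [|k [T [T0 pT]]].
  by exists 1%N; split=> // n; rewrite !part_le1.
(* Unrolling [part_leS] N T times adds N T values of [part_le k.+1]; modulo N they run N times
   through a period, so their sum vanishes. *)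
exists (N * T * k.+2)%N; split=> [|n]; first by rewrite !muln_gt0 N0 T0.
pose F i := part_le k.+1 (n + i.+1 * k.+2).
have pE j : part_le k.+2 (n + j * k.+2) =
    (part_le k.+2 n + \sum_(0 <= i < j) F i)%N.
  elim: j => [|j IHj]; first by rewrite mul0n big_geq // !addn0.
  rewrite big_nat_recr //= addnA -IHj part_leS addnC ifT; last by lia.
  by congr (part_le _ _ + _)%N; lia.
have FT i : (F (i + T) %% N = F i %% N)%N.
  rewrite /F -addSn mulnDl addnA [(T * _)%N]mulnC.
  by rewrite (is_periodM (u := fun n => part_le k.+1 n %% N)%N).
rewrite pE -modnDmr -modn_summ -[(N * T)%N]add0n sum_periodic //.
by rewrite big_geq // add0n modnMr addn0.
Qed.

(** By [part_leS], p_{<=k}(m) is a difference of two values of p_{<=k+1} as soon as m > k. *)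
Lemma part_le_period_pred (N k T : nat) : (0 < N)%N -> (0 < k)%N ->
  is_period (fun n => part_le k.+1 n %% N)%N T ->
  is_period (fun n => part_le k n %% N)%N T.
Proof.
move=> N0 k0 [T0 pT]; split=> // n.
(* Small arguments are moved beyond k by multiples of a period U already known to exist for k. *)
have [U uU] := part_le_period N0 k0.
have U0 : (0 < U)%N by case: uU.
have kU : (k < n + k.+1 * U)%N by apply: ltn_addl; rewrite leq_pmulr.
rewrite -(is_periodM k.+1 (n + T) uU) -(is_periodM k.+1 n uU) addnAC /=.
set m := (n + _)%N in kU *.
apply/eqP; rewrite -(eqn_modDr (part_le k.+1 (m - k.+1))); apply/eqP.
have -> : (part_le k m + part_le k.+1 (m - k.+1))%N = part_le k.+1 m.
  by rewrite [RHS]part_leS kU.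
have mT : part_le k.+1 (m + T) =
    (part_le k (m + T) + part_le k.+1 (m - k.+1 + T))%N.
  by rewrite [LHS]part_leS ltn_addr // addnBAC.
by rewrite -pT mT -modnDmr -(pT (m - k.+1)%N) modnDmr.
Qed.

(** The period ratios telescope to [part_period N k], and the extra factors N keep the product a
    positive multiple of it. *)
Lemma part_period'_period (N k : nat) : (0 < N)%N -> (0 < k)%N ->
  is_period (fun n => part_le k n %% N)%N (part_period' N k).
Proof.
move=> N0; case: k => // k _.
have per j := min_periodP (part_le_period N0 (ltn0Sn j)).
have main : (part_period N k.+1 %| part_period' N k.+1)%N &&
    (0 < part_period' N k.+1)%N.
  elim: k => [|k /andP[dv p0]].
    by rewrite andbT; apply: min_period_dvd; split=> // n; rewrite !part_le1.
  have pd : (part_period N k.+1 %| part_period N k.+2)%N.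
    by apply/min_period_dvd/part_le_period_pred => //; case: (per k.+1).
  have rE : part_period N k.+2 = (period_ratio N k.+2 * part_period N k.+1)%N.
    by rewrite /period_ratio divnK.
  have r0 : (0 < period_ratio N k.+2)%N.
    have : (0 < part_period N k.+2)%N by case: (per k.+1) => [[]].
    by rewrite rE muln_gt0 => /andP[].
  rewrite rE /=; case: ifP => _; rewrite !muln_gt0 ?N0 r0 p0 andbT.
    by rewrite dvdn_mul.
  by rewrite -mulnA dvdn_mull // dvdn_mul.
case/andP: main => /dvdnP[c cE] p0; split=> // n.
by rewrite cE; exact: (is_periodM c n (per k).1).
Qed.

(** * Convolution and Euler products *)

(** Extension by 0 to negative arguments makes the recurrence [ptnS] hold on all integers. *)
Definition ptn (k : nat) (z : int) : int :=
  if z is Posz n then (part_le k n)%:Z else 0.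

(** Polynomials act on two-sided sequences, with ['X] as the shift z -> z - 1. This replaces power
    series: C / D_k becomes C acting on [ptn k]. *)
Definition conv (c : {poly int}) (u : int -> int) (z : int) : int :=
  \sum_(i < size c) c`_i * u (z - i%:Z).

Section Convolution.

Variable u : int -> int.

Lemma conv_wide (n : nat) (c : {poly int}) (z : int) : (size c <= n)%N ->
  conv c u z = \sum_(i < n) c`_i * u (z - i%:Z).
Proof.
move=> sn; rewrite /conv (big_ord_widen n (fun i => c`_i * u (z - i%:Z)) sn).
rewrite big_mkcond; apply: eq_bigr => i _; case: ltnP => // si.
by rewrite nth_default // mul0r.
Qed.

Lemma conv0 (z : int) : conv 0 u z = 0.
Proof. by rewrite /conv size_poly0 big_ord0. Qed.

Lemma convD (c d : {poly int}) (z : int) :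
  conv (c + d) u z = conv c u z + conv d u z.
Proof.
set n := maxn (size c) (size d).
rewrite (@conv_wide n (c + d)) ?size_polyD // (@conv_wide n c) ?leq_maxl //.
rewrite (@conv_wide n d) ?leq_maxr // -big_split /=.
by apply: eq_bigr => i _; rewrite coefD mulrDl.
Qed.

Lemma convZ (a : int) (c : {poly int}) (z : int) :
  conv (a *: c) u z = a * conv c u z.
Proof.
rewrite (@conv_wide (size c) (a *: c)) ?size_scale_leq // mulr_sumr.
by apply: eq_bigr => i _; rewrite coefZ mulrA.
Qed.

Lemma convN (c : {poly int}) (z : int) : conv (- c) u z = - conv c u z.
Proof. by rewrite -scaleN1r convZ mulN1r. Qed.

Lemma conv_sum (n : nat) (F : 'I_n -> {poly int}) (z : int) :
  conv (\sum_(i < n) F i) u z = \sum_(i < n) conv (F i) u z.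
Proof. by rewrite (big_morph _ (fun c d => convD c d z) (conv0 z)). Qed.

Lemma conv1 (z : int) : conv 1 u z = u z.
Proof. by rewrite /conv size_poly1 big_ord1 coef1 mul1r subr0. Qed.

Lemma convMX (c : {poly int}) (z : int) : conv (c * 'X) u z = conv c u (z - 1).
Proof.
rewrite (@conv_wide (size c).+1) ?(leq_trans (size_polyMleq _ _)) //; last first.
  by rewrite size_polyX addn2.
rewrite big_ord_recl coefMX mul0r add0r; apply: eq_bigr => i _.
by rewrite coefMX /=; congr (_ * u _); rewrite /bump; lia.
Qed.

Lemma convMXn (m : nat) (c : {poly int}) (z : int) :
  conv ('X^m * c) u z = conv c u (z - m%:Z).
Proof.
elim: m z => [|m IHm] z; first by rewrite mul1r subr0.
rewrite exprSr mulrAC convMX IHm; congr conv; lia.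
Qed.

End Convolution.

Lemma eq_conv (u v : int -> int) (c : {poly int}) (z : int) :
  u =1 v -> conv c u z = conv c v z.
Proof. by move=> uv; apply: eq_bigr => i _; rewrite uv. Qed.

Lemma convM (u : int -> int) (c d : {poly int}) (z : int) :
  conv (c * d) u z = conv c (conv d u) z.
Proof.
elim/poly_ind: c z => [|c a IHc] z; first by rewrite mul0r !conv0.
rewrite mulrDl mulrAC !convD !convMX IHc; congr (_ + _).
by rewrite mul_polyC convZ -alg_polyC convZ conv1.
Qed.

Lemma conv_delta (c : {poly int}) (a : nat) :
  conv c (fun z => (z == 0)%:R) a%:Z = c`_a.
Proof.
have sn := leq_maxl (size c) a.+1; have an := leq_maxr (size c) a.+1.
rewrite (conv_wide _ _ sn) (bigD1 (Ordinal an)) //= subrr eqxx mulr1.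
rewrite big1 ?addr0 // => i; rewrite -val_eqE /= => ia.
by rewrite subr_eq0 eqz_nat eq_sym (negbTE ia) mulr0.
Qed.

Definition euler_prod (k : nat) : {poly int} := \prod_(1 <= i < k.+1) (1 - 'X^i).

Lemma euler_prod0 : euler_prod 0 = 1.
Proof. exact: big_geq. Qed.

Lemma euler_prodS (k : nat) :
  euler_prod k.+1 = euler_prod k * (1 - 'X^(k.+1)).
Proof. exact: big_nat_recr. Qed.

Lemma size_1subXn (m : nat) : size (1 - 'X^(m.+1) : {poly int}) = m.+2.
Proof. by rewrite -opprB size_polyN size_XnsubC. Qed.

Lemma lead_coef_1subXn (m : nat) :
  lead_coef (1 - 'X^(m.+1) : {poly int}) = -1.
Proof. by rewrite -opprB lead_coefN lead_coefXnsubC. Qed.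

(** Each factor contributes -1. Invertibility over the integers is what allows the recurrence to be
    run backwards. *)
Lemma lead_coef_euler_prod (k : nat) : lead_coef (euler_prod k) \is a GRing.unit.
Proof.
elim: k => [|k IHk]; first by rewrite euler_prod0 lead_coef1 unitr1.
by rewrite euler_prodS lead_coefM lead_coef_1subXn unitrM IHk.
Qed.

Lemma euler_prod_neq0 (k : nat) : euler_prod k != 0.
Proof. by rewrite -lead_coef_eq0; apply: contraTneq (lead_coef_euler_prod k) => ->. Qed.

Lemma size_euler_prodS (k : nat) :
  size (euler_prod k.+1) = (size (euler_prod k) + k.+1)%N.
Proof.
have n0 : 1 - 'X^(k.+1) != 0 :> {poly int} by rewrite -size_poly_eq0 size_1subXn.
by rewrite euler_prodS size_mul ?euler_prod_neq0 // size_1subXn addnS.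
Qed.

Lemma ptnS (k : nat) (z : int) :
  ptn k.+1 z - ptn k.+1 (z - k.+1%:Z) = ptn k z.
Proof.
case: z => n; last first.
  have [m ->] : exists m, Negz n - k.+1%:Z = Negz m by exists (n + k.+1)%N; lia.
  by rewrite subr0.
rewrite /= part_leS; case: ltnP => kn.
  have -> : n%:Z - k.+1%:Z = (n - k.+1)%N%:Z by lia.
  by rewrite /=; lia.
have [m ->] : exists m, n%:Z - k.+1%:Z = Negz m by exists (k - n)%N; lia.
by rewrite /= addn0 subr0.
Qed.

(* Euler's generating function: the power series of [ptn k] is the inverse of
   [euler_prod k]. *)
Lemma conv_euler_ptn (k : nat) (z : int) :
  conv (euler_prod k) (ptn k) z = (z == 0)%:R.
Proof.
elim: k z => [|k IHk] z.
  by rewrite euler_prod0 conv1; case: z => //= n; rewrite part_le0 eqz_nat natz.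
rewrite euler_prodS convM -IHk; apply: eq_conv => y.
by rewrite convD convN conv1 -['X^_]mulr1 convMXn conv1 ptnS.
Qed.

(** * Gaussian polynomials *)

Definition qint (i : nat) : {poly int} := \poly_(j < i) 1.

Lemma qintM (i : nat) : qint i * (1 - 'X) = 1 - 'X^i.
Proof.
have -> : qint i = \sum_(j < i) 'X^j.
  by rewrite /qint poly_def; apply: eq_bigr => j _; rewrite scale1r.
by rewrite -[1 - 'X^i]opprB subrX1 mulrC -mulNr opprB.
Qed.

Lemma unit_lead_coef_1subX : lead_coef (1 - 'X : {poly int}) \is a GRing.unit.
Proof. by rewrite -['X]expr1 lead_coef_1subXn. Qed.

Lemma qfactS (m : nat) : qfact m.+1 = qfact m * qint m.+1.
Proof.
rewrite /qfact big_nat_recr //= -qintM.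
by rewrite Pdiv.IdomainUnit.mulpK // unit_lead_coef_1subX.
Qed.

Lemma qfact0 : qfact 0 = 1.
Proof. exact: big_geq. Qed.

Lemma qfact_euler_prod (m : nat) : qfact m * (1 - 'X) ^+ m = euler_prod m.
Proof.
elim: m => [|m IHm]; first by rewrite qfact0 euler_prod0 mulr1.
by rewrite qfactS euler_prodS exprSr mulrACA IHm qintM.
Qed.

Lemma lead_coef_qfact (m : nat) : lead_coef (qfact m) = 1.
Proof.
elim: m => [|m IHm]; first by rewrite qfact0 lead_coef1.
by rewrite qfactS lead_coefM IHm mul1r lead_coef_poly.
Qed.

Lemma qintD (m k : nat) : qint (m + k) = qint m + 'X^m * qint k.
Proof.
have n0 : 1 - 'X != 0 :> {poly int}.
  by rewrite -lead_coef_eq0; apply: contraTneq unit_lead_coef_1subX => ->.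
by apply: (mulIf n0); rewrite mulrDl -mulrA !qintM exprD; ring.
Qed.

(* Pascal's rule for Gaussian polynomials makes the quotient of q-factorials
   exact over the integers. *)
Lemma qfact_dvd (m k : nat) :
  exists g, qfact (m + k) = g * (qfact m * qfact k).
Proof.
elim: m k => [|m IHm] k; first by exists 1; rewrite qfact0 !mul1r.
elim: k => [|k [g2 IHk]]; first by exists 1; rewrite addn0 qfact0 mulr1 mul1r.
have [g1 E1] := IHm k.+1.
exists (g1 + 'X^(m.+1) * g2).
rewrite addnS qfactS -addnS qintD mulrDr {1}addSn -addnS E1 IHk.
by rewrite !qfactS; ring.
Qed.

(** The quotient is exact by [qfact_dvd], and [qfact] differs from [euler_prod] by a power of 1 - X;
    multiplication by D_m turns both sides into D_{m+k}. *)
Lemma gauss_euler_prod (m k : nat) :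
  gauss (m + k) k * euler_prod k = \prod_(1 <= i < k.+1) (1 - 'X^(m + i)).
Proof.
have [g gE] := qfact_dvd m k.
have -> : gauss (m + k) k = g.
  rewrite /gauss addnK gE Pdiv.IdomainUnit.mulpK //.
  by rewrite lead_coefM !lead_coef_qfact mulr1 unitr1.
apply: (mulIf (euler_prod_neq0 m)).
have -> : g * euler_prod k * euler_prod m = euler_prod (m + k).
  by rewrite -!qfact_euler_prod gE exprD; ring.
elim: k {g gE} => [|k IHk]; first by rewrite addn0 big_geq // mul1r.
by rewrite addnS euler_prodS IHk [in RHS]big_nat_recr //= addnS mulrAC.
Qed.

(* The coefficient of [Y^l] in [prod_(1 <= i <= k) (1 - Y X^i)], where [Y] is
   the outer indeterminate; [Y = X^m] gives the numerator of the Gaussian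
   polynomial. *)
Definition biprod (k : nat) : {poly {poly int}} :=
  \prod_(1 <= i < k.+1) (1 - ('X^i)%:P * 'X).

Lemma biprod0 : biprod 0 = 1.
Proof. exact: big_geq. Qed.

Lemma biprodS (k : nat) :
  biprod k.+1 = biprod k - biprod k * ('X^(k.+1))%:P * 'X.
Proof. by rewrite [LHS]big_nat_recr //= mulrBr mulr1 mulrA. Qed.

Lemma biprodS_coef (k l : nat) : (biprod k.+1)`_l =
  (biprod k)`_l - (if l is l'.+1 then (biprod k)`_l' * 'X^(k.+1) else 0).
Proof. by rewrite biprodS coefB coefMX; case: l => //= l; rewrite coefMC. Qed.

Lemma size_biprod (k : nat) : (size (biprod k) <= k.+1)%N.
Proof.
elim: k => [|k IHk]; first by rewrite biprod0 size_poly1.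
apply/leq_sizeP => j kj; rewrite biprodS_coef !nth_default ?sub0r.
- by case: j kj => [//|j] kj; rewrite nth_default ?mul0r ?oppr0 // (leq_trans IHk).
- exact: leq_trans IHk (ltnW kj).
Qed.

Lemma horner_biprod (m k : nat) :
  (biprod k).['X^m] = \prod_(1 <= i < k.+1) (1 - 'X^(m + i)).
Proof.
rewrite horner_prod; apply: eq_bigr => i _.
by rewrite !hornerE -exprD addnC.
Qed.

(** Up to sign, the coefficient of Y^l sums X^(i_1 + ... + i_l) over the l-subsets of {1, ..., k};
    for l < k its degree stays below 1 + ... + k = deg D_k. *)
Lemma size_biprod_coef (k l : nat) :
  (size ((biprod k)`_l)%R <= (size (euler_prod k)).-1 + (k <= l))%N.
Proof.
elim: k l => [|k IHk] l.
  by rewrite biprod0 euler_prod0 coef1 size_poly1; case: l => [|l]; rewrite ?size_poly1 ?size_poly0.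
have e0 : (0 < size (euler_prod k))%N by rewrite size_poly_gt0 euler_prod_neq0.
rewrite biprodS_coef size_euler_prodS (leq_trans (size_polyD _ _)) //.
rewrite size_polyN geq_max; apply/andP; split.
  by have := IHk l; case: (k <= l)%N; case: (k < l)%N; lia.
case: l => [|l]; first by rewrite size_poly0.
rewrite (leq_trans (size_polyMleq _ _)) // size_polyXn.
have := IHk l; rewrite ltnS; move: e0.
move: (size _) (size _) (nat_of_bool _) => a b c; lia.
Qed.

(** For l > 0 every monomial contains some X^i with i >= 1. This kills the term l = j + 1 at the
    right end (j + 1) m of a window. *)
Lemma biprod_coef_coef0 (k l : nat) : (0 < l)%N -> (biprod k)`_l`_0 = 0.
Proof.
move=> l0; elim: k => [|k IHk].
  by rewrite biprod0 coef1 gtn_eqF // coef0.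
by rewrite biprodS_coef; case: l l0 IHk => // l _ IHk; rewrite coefB IHk coefMXn subr0.
Qed.

(** Acting on [ptn k] inverts [euler_prod k]; the numerator is [biprod k] at Y = X^m, and Y^l shifts
    the argument by l m. *)
Lemma gauss_coef (m k a : nat) : (gauss (m + k) k)`_a =
  \sum_(l < k.+1) conv (biprod k)`_l (ptn k) (a%:Z - (l * m)%N%:Z).
Proof.
rewrite -conv_delta -(eq_conv _ _ (conv_euler_ptn k)) -convM gauss_euler_prod.
rewrite -horner_biprod (horner_coef_wide _ (size_biprod k)) conv_sum.
by apply: eq_bigr => l _; rewrite mulrC -exprM mulnC convMXn.
Qed.

(** * Coefficients modulo [N] *)

Lemma dvdz_sum (N : int) (n : nat) (F : 'I_n -> int) :
  (forall i, N %| F i)%Z -> (N %| \sum_(i < n) F i)%Z.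
Proof. by move=> dF; elim/big_ind: _ => // x y; exact: rpredD. Qed.

Section Shift.

Variables (N k T : nat).
Hypothesis pT : is_period (fun n => part_le k n %% N)%N T.

Lemma dvdz_ptn_shift_nat (n : nat) :
  (N %| ptn k (n%:Z + T%:Z) - ptn k n%:Z)%Z.
Proof.
rewrite -eqz_mod_dvd /= !modz_nat; apply/eqP; congr Posz.
by case: pT => _ ->.
Qed.

(* [ptn k] vanishes on negative arguments, so this says that the periodic
   extension of [ptn k] to the left has a run of zeros of length one less than
   the degree of [euler_prod k]; the recurrence given by [euler_prod k], run
   backwards, forces it. *)
Lemma dvdz_ptn_shift (z : int) : - (size (euler_prod k)).-1%:Z < z ->
  (N %| ptn k (z + T%:Z) - ptn k z)%Z.
Proof.
case: z => [n _|j]; first exact: dvdz_ptn_shift_nat.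
rewrite NegzE; have [j1 jE] : {j1 | j.+1 = j1} by exists j.+1.
rewrite jE; have j1_gt0 : (0 < j1)%N by rewrite -jE.
move: {j jE}j1 j1_gt0; elim/ltn_ind => j IHj j0 jd.
set d := (size (euler_prod k)).-1 in IHj jd.
have dS : size (euler_prod k) = d.+1.
  by rewrite /d prednK // size_poly_gt0 euler_prod_neq0.
pose e z := ptn k (z + T%:Z) - ptn k z.
have conv_e z : 0 < z -> conv (euler_prod k) e z = 0.
  move=> z0; have -> : conv (euler_prod k) e z =
      conv (euler_prod k) (ptn k) (z + T%:Z) - conv (euler_prod k) (ptn k) z.
    rewrite /conv -sumrB; apply: eq_bigr => i _; rewrite -mulrBr /e.
    by congr (_ * (ptn k _ - _)); lia.
  rewrite !conv_euler_ptn.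
  have -> : (z + T%:Z == 0) = false by lia.
  by have -> : (z == 0) = false by lia.
(* At d - j > 0 the term i = d of the recurrence is e(-j) times a unit, and all other terms have
   arguments above -j. *)
have dconv : (N %| conv (euler_prod k) e (d%:Z - j%:Z))%Z.
  by rewrite conv_e ?dvdz0 //; lia.
have dlow : (N %| \sum_(i < d) (euler_prod k)`_i * e (d%:Z - j%:Z - i%:Z))%Z.
  apply: dvdz_sum => i; apply: dvdz_mull.
  have [ij|ij] := leqP (i + j) d.
    have -> : d%:Z - j%:Z - i%:Z = (d - j - i)%N%:Z by lia.
    exact: dvdz_ptn_shift_nat.
  have -> : d%:Z - j%:Z - i%:Z = - (i + j - d)%N%:Z by lia.
  by have id := ltn_ord i; apply: IHj; lia.
move: dconv; rewrite /conv dS big_ord_recr /= (rpredDl _ dlow).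
have -> : d%:Z - j%:Z - d%:Z = - j%:Z by lia.
have -> : (euler_prod k)`_d = lead_coef (euler_prod k) by [].
move=> dtop; rewrite -/(e _) -(mulKr (lead_coef_euler_prod k) (e _)).
exact: dvdz_mull.
Qed.

(** The size bound keeps all arguments of [ptn k] above -deg D_k, the range of [dvdz_ptn_shift]. *)
Lemma dvdz_conv_ptn_shift (c : {poly int}) (a : nat) :
  (size c < size (euler_prod k))%N ->
  (N %| conv c (ptn k) (a%:Z + T%:Z) - conv c (ptn k) a%:Z)%Z.
Proof.
move=> sc; rewrite /conv -sumrB; apply: dvdz_sum => i.
rewrite -mulrBr; apply: dvdz_mull.
have -> : a%:Z + T%:Z - i%:Z = a%:Z - i%:Z + T%:Z by lia.
by have := ltn_ord i; move=> ic; apply: dvdz_ptn_shift; lia.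
Qed.

End Shift.

Lemma conv_ptn_lt0 (c : {poly int}) (k : nat) (z : int) : z < 0 ->
  conv c (ptn k) z = 0.
Proof.
move=> z0; rewrite /conv big1 // => i _.
have [m ->] : exists m, z - i%:Z = Negz m by exists (`|z - i%:Z|.-1)%N; lia.
by rewrite mulr0.
Qed.

Lemma conv_ptn_le0 (c : {poly int}) (k : nat) (z : int) : c`_0 = 0 -> z <= 0 ->
  conv c (ptn k) z = 0.
Proof.
move=> c0; rewrite le_eqVlt => /predU1P[->|]; last exact: conv_ptn_lt0.
rewrite /conv big1 // => -[[|i] ilt] _ /=; first by rewrite c0 mul0r.
by rewrite mulr0.
Qed.

Definition window_coef (k j m b : nat) : int :=
  \sum_(l < j.+1) conv (biprod k)`_l (ptn k) ((j - l) * m + b)%N%:Z.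

(* On the window [j m < a <= (j + 1) m] only the first [j + 1] terms of
   [gauss_coef] survive. *)
Lemma gauss_coef_window (k j m b : nat) : (j < k)%N -> (0 < b <= m)%N ->
  (gauss (m + k) k)`_(j * m + b) = window_coef k j m b.
Proof.
move=> jk /andP[b0 bm]; rewrite gauss_coef /window_coef.
rewrite (big_ord_widen k.+1
  (fun l => conv (biprod k)`_l (ptn k) ((j - l) * m + b)%N%:Z)) ?ltnS 1?ltnW //.
rewrite [RHS]big_mkcond; apply: eq_bigr => l _; rewrite ltnS.
case: leqP => lj.
  congr conv; rewrite mulnBl.
  have : (l * m <= j * m)%N by rewrite leq_mul2r lj orbT.
  lia.
(* For l > j the argument is at most b - m <= 0, with value 0 exactly when l = j + 1 and b = m. *)
apply: conv_ptn_le0; first by apply: biprod_coef_coef0; lia.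
have : (j.+1 * m <= l * m)%N by rewrite leq_mul2r lj orbT.
by rewrite mulSn; lia.
Qed.

(** Index 0 lies in no window and is treated apart; its coefficient does not depend on m. *)
Lemma gauss_coef0 (k m : nat) : (gauss (m + k) k)`_0 = window_coef k 0 0 0.
Proof.
rewrite gauss_coef /window_coef big_ord_recl big_ord1 /= mul0n subr0.
rewrite big1 ?addr0 // => l _; apply: conv_ptn_le0; last by lia.
exact: biprod_coef_coef0.
Qed.

Lemma size_biprod_coef_lt (k l : nat) : (l < k)%N ->
  (size ((biprod k)`_l)%R < size (euler_prod k))%N.
Proof.
move=> lk; have := size_biprod_coef k l; rewrite [(k <= l)%N]leqNgt lk addn0.
have : (0 < size (euler_prod k))%N by rewrite size_poly_gt0 euler_prod_neq0.
by move: (size _) (size _) => a b; lia.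
Qed.

(** Since l <= j < k, each term is T-periodic modulo N in its argument (j - l) m + b, whose class
    modulo T depends only on those of m and b. *)
Lemma dvdz_window_coef (N k T j m b m' b' : nat) : (j < k)%N ->
  is_period (fun n => part_le k n %% N)%N T ->
  (m' = m %[mod T])%N -> (b' = b %[mod T])%N ->
  (N %| window_coef k j m' b' - window_coef k j m b)%Z.
Proof.
move=> jk pT mm bb; rewrite /window_coef -sumrB; apply: dvdz_sum => l.
have sl : (size ((biprod k)`_l)%R < size (euler_prod k))%N.
  by apply: size_biprod_coef_lt; have := ltn_ord l; lia.
set c := (biprod k)`_l in sl *.
have red x : (N %| conv c (ptn k) x%:Z - conv c (ptn k) (x %% T)%N%:Z)%Z.
  rewrite {1}(divn_eq x T) addnC.
  elim: (x %/ T)%N => [|q IHq]; first by rewrite addn0 subrr dvdz0.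
  rewrite mulSn [(T + _)%N]addnC addnA PoszD -(subrKA (conv c (ptn k) (x %% T + q * T)%N%:Z)).
  by rewrite rpredD // dvdz_conv_ptn_shift.
have E : ((j - l) * m' + b' = (j - l) * m + b %[mod T])%N.
  by rewrite -modnDm -modnMmr mm bb modnMmr modnDm.
have := rpredB (red ((j - l) * m' + b')%N) (red ((j - l) * m + b)%N).
by rewrite E opprB addrA subrK.
Qed.

(** * Counting the coefficients window by window *)

Section Counting.

Variables (N k : nat) (R : 'I_N).

(** Windows start at j m + 1 while b starts at 0, hence [b.+1]. The truth value is taken in [nat] so
    that sums count hits. *)
Definition window_hit (j m b : nat) : nat :=
  (window_coef k j m b.+1 == (R : nat)%:Z %[mod N])%Z.

Lemma coef_count_window (m : nat) : coef_count k R (m + k) =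
  ((window_coef k 0 0 0 == (R : nat)%:Z %[mod N])%Z +
     \sum_(0 <= j < k) \sum_(0 <= b < m) window_hit j m b)%N.
Proof.
pose F (a : nat) : nat := ((gauss (m + k) k)`_a == (R : nat)%:Z %[mod N])%Z.
have -> : coef_count k R (m + k) = (\sum_(0 <= a < (k * m).+1) F a)%N.
  rewrite big_mkord /coef_count addnK -sum1_card [LHS]big_mkcond /=.
  by apply: eq_bigr => a _; rewrite inE /F; case: eqP.
(* The indices 0, ..., k m split into 0 and k windows of length m. *)
rewrite big_nat_recl //= {1}/F gauss_coef0 big_nat_mul; congr (_ + _)%N.
apply: eq_big_nat => j /andP[_ jk].
rewrite -{1}[(j * m)%N]add0n big_addn mulSn addnK.
apply: eq_big_nat => b /andP[_ bm].
by rewrite /F /window_hit [(b + _)%N]addnC -addnS gauss_coef_window.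
Qed.

Variable T : nat.
Hypothesis pT : is_period (fun n => part_le k n %% N)%N T.

Lemma window_hit_mod (j m b m' b' : nat) : (j < k)%N ->
  (m' = m %[mod T])%N -> (b' = b %[mod T])%N ->
  window_hit j m' b' = window_hit j m b.
Proof.
move=> jk mm bb; rewrite /window_hit.
have /eqP -> // : (window_coef k j m' b'.+1 == window_coef k j m b.+1 %[mod N])%Z.
rewrite eqz_mod_dvd; apply: dvdz_window_coef pT mm _ => //.
by rewrite -addn1 -modnDml bb modnDml addn1.
Qed.

(** For m = r + t T each window consists of r positions and t full periods, and the hits depend on m
    only through r; the slope counts the hits in one period of every window. *)
Lemma coef_count_linear (r : nat) : exists A B : nat, forall t : nat,
  coef_count k R (r + t * T + k) = (A + t * B)%N.
Proof.
exists ((window_coef k 0 0 0 == (R : nat)%:Z %[mod N])%Z +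
  \sum_(0 <= j < k) \sum_(0 <= b < r) window_hit j r b)%N.
exists (\sum_(0 <= j < k) \sum_(0 <= b < T) window_hit j r b)%N => t.
rewrite coef_count_window -addnA; congr (_ + _)%N.
rewrite big_distrr -big_split /=; apply: eq_big_nat => j /andP[_ jk].
rewrite -sum_periodic => [|b]; last by apply: window_hit_mod; rewrite ?modnDr.
by apply: eq_big_nat => b _; apply: window_hit_mod; rewrite // addnC modnMDl.
Qed.

End Counting.

Theorem theorem4p3 (N k : nat) (R : 'I_N) (hN : (0 < N)%N) (hk : (1 <= k)%N) :
  let Q := part_period' N k in
  quasipolynomial_from k Q (coef_count k R) /\
  forall i : nat, (i < Q)%N ->
    exists a b : rat, forall n : nat, (k <= n)%N -> (n = i %[mod Q])%N ->
      (coef_count k R n)%:R = a * ((n%:R - i%:R) / Q%:R) + b.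
Proof.
move=> Q; have pQ : is_period (fun n => part_le k n %% N)%N Q.
  exact: part_period'_period.
have Q0 : (0 < Q)%N by case: pQ.
have Q_neq0 : Q%:R != 0 :> rat by rewrite pnatr_eq0 -lt0n.
have lin i : exists a b : rat, forall n : nat,
    (k <= n)%N -> (n = i %[mod Q])%N ->
    (coef_count k R n)%:R = a * ((n%:R - i%:R) / Q%:R) + b.
  (* This is the residue of n - k modulo Q; adding k (Q - 1) stands for subtracting k. *)
  pose r := ((i + k * Q.-1) %% Q)%N.
  have [A [B AB]] := coef_count_linear R pQ r.
  (* Substitute t = (n - k - r) / Q = (n - i) / Q - (r + k - i) / Q in A + t B. *)
  exists B%:R, (A%:R - B%:R * ((r%:R + k%:R - i%:R) / Q%:R)) => n kn ni.
  have nE : n = (r + (n - k) %/ Q * Q + k)%N.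
    have rE : r = ((n - k) %% Q)%N.
      rewrite /r -modnDml -ni modnDml -{1}(subnK kn) -addnA -mulnS prednK //.
      by rewrite addnC modnMDl.
    by rewrite rE addnC [(_ %% _ + _)%N]addnC -divn_eq subnKC.
  rewrite {1}nE AB {2}nE !natrD !natrM.
  by field.
split=> //; split=> //.
have lin' (i : 'I_Q) : exists p : {poly rat}, forall n : nat,
    (k <= n)%N -> (n = i %[mod Q])%N -> (coef_count k R n)%:R = p.[n%:R].
  have [a [b ab]] := lin i.
  exists ((a / Q%:R)%:P * ('X - i%:R%:P) + b%:P) => n kn ni.
  by rewrite (ab n kn ni) hornerD hornerM hornerXsubC !hornerC mulrA mulrAC.
have [P PE] := fin_all_exists lin'.
by exists P => i n; apply: PE.
Qed.
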